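(* Let $U$ and $V$ be theories and let $K:U\to V$ and $M:V\to U$ be interpretations such that $K\circ M:V\to V$ is i-isomorphic to ${\sf id}_V$ (i.e. $V$ is an ${\sf INT}_1$-retract of $U$ via $K,M$) and $U\vdash A^{M\circ K}\leftrightarrow A$ for every $U$-sentence $A$ (i.e. $U$ is an ${\sf INT}_3$-retract of $V$ via $K,M$). Suppose further that $M$ is direct. Then $U$ and $V$ are synonymous.
   Context: Theories are one-sorted first-order theories in a relational signature, with identity as a logical constant. An $m$-dimensional interpretation $K:U\to V$ is given by a $V$-formula $\delta_K(\vec x)$ with $\vec x$ of length $m$ and, for each $n$-ary predicate $P$ of $U$ (including identity, translated to $=_K$), a $V$-formula $P_K(\vec x_0,\dots,\vec x_{n-1})$; the translation $A^K$ commutes with connectives and relativizes quantifiers to $\delta_K$; it is required that $U\vdash A$ implies $V\vdash A^K$ for all $U$-sentences $A$. For $K:U\to V$, $M:V\to W$, the composition $M\circ K:U\to W$ translates first by $K$ then by $M$; ${\sf id}_T$ is the identity interpretation. A one-dimensional interpretation $M$ is direct if $\delta_M(x)$ is $x=x$ and $x=_M y$ is $x=y$. An i-isomorphism between interpretations $K,K':U\to V$ (of dimensions $m,k$) is a $V$-formula $F(\vec x,\vec y)$ such that $V$ proves: $F(\vec x,\vec y)$ implies $\delta_K(\vec x)\wedge\delta_{K'}(\vec y)$; $F$ respects $=_K$ and $=_{K'}$; $F$ is total on $\delta_K$ and onto $\delta_{K'}$; $F$ is functional modulo $=_{K'}$ and injective modulo $=_K$; and for each predicate $P$ of $U$, if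 $\vec x_iF\vec y_i$ for all $i<n$ then $P_K(\vec x_0,\dots)\leftrightarrow P_{K'}(\vec y_0,\dots)$. Two interpretations $K,K':U\to V$ are equal (in ${\sf INT}_0$) if they have the same dimension and $V$ proves $\delta_K\leftrightarrow\delta_{K'}$ and, on $\delta_K$, $P_K\leftrightarrow P_{K'}$ for each predicate $P$ (including identity). $U$ and $V$ are synonymous iff there are interpretations $K:U\to V$, $M:V\to U$ with $M\circ K$ equal to ${\sf id}_U$ and $K\circ M$ equal to ${\sf id}_V$. *)

(* Defs.v *)
From mathcomp Require Import all_boot.
From Stdlib Require List.

Set Implicit Arguments.
Unset Strict Implicit.
Unset Printing Implicit Defensive.

(* Syntax: one-sorted first-order logic with identity over a relational
   signature.  Variables are de Bruijn indices; as there are no function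
   symbols, the only terms are variables, so that substitution is renaming. *)

Record signature := Signature { pred_sym :> Type; arity : pred_sym -> nat }.

Inductive form (S : signature) : Type :=
| Bot
| Eq of nat & nat
| Rel (P : S) of (arity P).-tuple nat
| Imp of form S & form S
| All of form S.

Arguments Bot {S}.
Arguments Eq {S} _ _.
Arguments Rel {S} P _.

Section Syntax.
Variable S : signature.
Implicit Types A B : form S.

Definition Neg A := Imp A Bot.
Definition Top : form S := Imp Bot Bot.
Definition And A B := Neg (Imp A (Neg B)).
Definition Iff A B := And (Imp A B) (Imp B A).
Definition Ex A := Neg (All (Neg A)).

(* [alls m A] and [exs m A] bind the variables 0, ..., m - 1 of A. *)
Definition alls (m : nat) A := iter m (@All S) A.
Definition exs (m : nat) A := iter m Ex A.

Definition conjs (n : nat) (f : nat -> form S) :=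
  foldr And Top [seq f i | i <- iota 0 n].

Definition up (s : nat -> nat) (i : nat) : nat :=
  if i is j.+1 then (s j).+1 else 0.

Fixpoint ren (s : nat -> nat) A : form S :=
  match A with
  | Bot => Bot
  | Eq i j => Eq (s i) (s j)
  | Rel P v => Rel P (map_tuple s v)
  | Imp A B => Imp (ren s A) (ren s B)
  | All A => All (ren (up s) A)
  end.

(* The free variables of A are among 0, ..., n - 1. *)
Fixpoint bounded (n : nat) A : bool :=
  match A with
  | Bot => true
  | Eq i j => (i < n) && (j < n)
  | Rel P v => all (fun i => i < n) v
  | Imp A B => bounded n A && bounded n B
  | All A => bounded n.+1 A
  end.

Definition sentence A : bool := bounded 0 A.

(* The renaming 0 |-> i, j + 1 |-> j. *)
Definition inst (i j : nat) : nat := if j is k.+1 then k else i.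

Record theory := Theory {
  axiom : form S -> Prop;
  axiom_sentence : forall A, axiom A -> sentence A }.

(* Natural deduction for classical logic with identity, from the axioms of T.
   Free variables of G and A denote arbitrary elements, and there are always
   variables to instantiate with, so that domains are nonempty as usual. *)
Inductive prv (T : theory) : seq (form S) -> form S -> Prop :=
| prv_ax G A : axiom T A -> prv T G A
| prv_hyp G A : List.In A G -> prv T G A
| prv_impI G A B : prv T (A :: G) B -> prv T G (Imp A B)
| prv_impE G A B : prv T G (Imp A B) -> prv T G A -> prv T G B
| prv_raa G A : prv T (Neg A :: G) Bot -> prv T G A
| prv_allI G A : prv T (map (ren succn) G) A -> prv T G (All A)
| prv_allE G A i : prv T G (All A) -> prv T G (ren (inst i) A)
| prv_eqI G i : prv T G (Eq i i)
| prv_eqE G A i j :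
    prv T G (Eq i j) -> prv T G (ren (inst i) A) -> prv T G (ren (inst j) A).

Definition proves (T : theory) A := prv T [::] A.

Lemma bounded_ren (s : nat -> nat) n k A :
  (forall i, i < n -> s i < k) -> bounded n A -> bounded k (ren s A).
Proof.
elim: A s n k => //= [i j|P v|A IHA B IHB|A IHA] s n k hs.
- by case/andP=> /hs -> /hs ->.
- by move=> hv; rewrite all_map; apply: sub_all hv => i /hs.
- by case/andP=> /(IHA _ _ _ hs) -> /(IHB _ _ _ hs) ->.
- by apply: IHA => -[|i] //=; rewrite !ltnS; apply: hs.
Qed.

Lemma bounded_le n k A : n <= k -> bounded n A -> bounded k A.
Proof.
elim: A n k => //= [i j|P v|A IHA B IHB|A IHA] n k le_nk.
- by case/andP=> hi hj; rewrite !(leq_trans _ le_nk).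
- by apply: sub_all => i hi; apply: leq_trans le_nk.
- by case/andP=> /(IHA _ _ le_nk) -> /(IHB _ _ le_nk) ->.
- exact: IHA.
Qed.

Lemma bounded_alls m n A : bounded (m + n) A -> bounded n (alls m A).
Proof. by elim: m n => //= m IHm n hA; apply: IHm; rewrite addnS. Qed.

Lemma bounded_conjs n k f :
  (forall i, i < n -> bounded k (f i)) -> bounded k (conjs n f).
Proof.
move=> hf; rewrite /conjs.
have: forall i, i \in iota 0 n -> bounded k (f i).
  by move=> i; rewrite mem_iota => /andP[_]; apply: hf.
elim: (iota 0 n) => //= i s IHs his.
by rewrite his ?mem_head //= IHs // => j js; rewrite his // inE js orbT.
Qed.

End Syntax.

Arguments Top {S}.

(* In a context of vectors of length m, the j-th component of the i-th vector
   is the variable i * m + j.  Thus [blk m f] sends the i-th vector of the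
   source context to the f(i)-th vector of the target context. *)
Definition blk (m : nat) (f : nat -> nat) (l : nat) : nat :=
  f (l %/ m) * m + l %% m.

Record translation (S S' : signature) := Translation {
  tdim : nat;
  tdom : form S';
  teq : form S';
  trel : forall P : S, form S';
  dom_bounded : bounded tdim tdom;
  eqt_bounded : bounded (2 * tdim) teq;
  rel_bounded : forall P, bounded (arity P * tdim) (trel P) }.

(* A^K: the vector of a variable i of A occupies the variables
   i * tdim K, ..., i * tdim K + tdim K - 1 of A^K. *)
Fixpoint tr (S S' : signature) (K : translation S S') (A : form S) : form S' :=
  match A with
  | Bot => Bot
  | Eq i j => ren (blk (tdim K) (nth 0 [:: i; j])) (teq K)
  | Rel P v => ren (blk (tdim K) (nth 0 v)) (trel K P)
  | Imp A B => Imp (tr K A) (tr K B)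
  | All A => alls (tdim K) (Imp (tdom K) (tr K A))
  end.

Definition interpretation (S S' : signature) (U : theory S) (V : theory S')
    (K : translation S S') : Prop :=
  forall A, sentence A -> proves U A -> proves V (tr K A).

Lemma blk_lt m f n k l :
  (forall i, i < n -> f i < k) -> l < n * m -> blk m f l < k * m.
Proof.
move=> hf hl.
have m_gt0: 0 < m by case: m hl => //; rewrite muln0.
have lt_k: f (l %/ m) < k by apply: hf; rewrite ltn_divLR.
apply: (@leq_trans ((f (l %/ m)).+1 * m)); last by rewrite leq_mul2r lt_k orbT.
by rewrite /blk mulSn addnC ltn_add2r ltn_mod.
Qed.

Lemma bounded_tr (S S' : signature) (K : translation S S') n A :
  bounded n A -> bounded (n * tdim K) (tr K A).
Proof.
elim: A n => //= [i j|P v|A IHA B IHB|A IHA] n.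
- case/andP=> hi hj; apply: bounded_ren (eqt_bounded K) => l.
  by apply: blk_lt => -[|[|]].
- move=> hv; apply: bounded_ren (rel_bounded K P) => l; apply: blk_lt => i hi.
  by apply: (allP hv); rewrite mem_nth // size_tuple.
- by case/andP=> /IHA -> /IHB ->.
- move=> /IHA hA; apply: bounded_alls; rewrite /= -mulSn hA andbT mulSn.
  apply: bounded_le (dom_bounded K); exact: leq_addr.
Qed.

Section Composition.
Variables S S' S'' : signature.
Variables (M : translation S' S'') (K : translation S S').

Definition comp_dom : form S'' :=
  And (conjs (tdim K) (fun j => ren (addn (j * tdim M)) (tdom M))) (tr M (tdom K)).

Lemma comp_dom_bounded : bounded (tdim K * tdim M) comp_dom.
Proof.
rewrite /= !andbT; apply/andP; split; last exact/bounded_tr/dom_bounded.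
apply: bounded_conjs => j hj; apply: bounded_ren (dom_bounded M) => l hl.
apply: (@leq_trans (j.+1 * tdim M)); last by rewrite leq_mul2r hj orbT.
by rewrite mulSn addnC ltn_add2r.
Qed.

Lemma comp_eqt_bounded : bounded (2 * (tdim K * tdim M)) (tr M (teq K)).
Proof. by rewrite mulnA; apply/bounded_tr/eqt_bounded. Qed.

Lemma comp_rel_bounded P : bounded (arity P * (tdim K * tdim M)) (tr M (trel K P)).
Proof. by rewrite mulnA; apply/bounded_tr/rel_bounded. Qed.

(* M o K, first K and then M.  The numbering of the components is that of
   (i * tdim K + j) * tdim M + l = i * (tdim K * tdim M) + (j * tdim M + l). *)
Definition tcomp : translation S S'' :=
  Translation comp_dom_bounded comp_eqt_bounded comp_rel_bounded.

End Composition.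

Section Identity.
Variable S : signature.

Definition id_dom : form S := Eq 0 0.
Definition id_eqt : form S := Eq 0 1.
Definition id_rel (P : S) : form S := Rel P (iota_tuple (arity P) 0).

Lemma id_rel_bounded P : bounded (arity P * 1) (id_rel P).
Proof. by apply/allP=> i; rewrite /= mem_iota muln1. Qed.

Definition tid : translation S S :=
  @Translation S S 1 id_dom id_eqt id_rel isT isT id_rel_bounded.

End Identity.

Definition direct (S S' : signature) (M : translation S S') : Prop :=
  [/\ tdim M = 1, tdom M = Eq 0 0 & teq M = Eq 0 1].

(* For a formula B(x, y) with x of length m: [at2 m a b B] is B with the vector
   x placed at the variables a, a + 1, ... and y at b, b + 1, ...  For a formula
   in a single vector (or a single block of vectors), [at1 a B] is similar. *)
Definition at1 (S : signature) (a : nat) (B : form S) : form S := ren (addn a) B.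
Definition at2 (S : signature) (m a b : nat) (B : form S) : form S :=
  ren (fun l => if l < m then a + l else b + (l - m)) B.

(* F(x, y) is an i-isomorphism from K to K', where the target theory is V.
   Open formulas are proved for all values of their free variables. *)
Record is_iiso (S S' : signature) (V : theory S') (K K' : translation S S')
    (F : form S') : Prop := IsIiso {
  iiso_bounded : bounded (tdim K + tdim K') F;
  (* x at 0, y at m *)
  iiso_dom : let m := tdim K in
    proves V (Imp F (And (tdom K) (at1 m (tdom K'))));
  (* x at 0, x' at m, y at 2 m, y' at 2 m + k *)
  iiso_resp : let m := tdim K in let k := tdim K' in
    proves V (Imp (And (at1 m (tdom K)) (at1 (2 * m + k) (tdom K')))
             (Imp (And (at2 m 0 m (teq K)) (at2 k (2 * m) (2 * m + k) (teq K')))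
             (Imp (at2 m 0 (2 * m) F) (at2 m m (2 * m + k) F))));
  (* x at 0, the quantifiers moving it to k *)
  iiso_total : let m := tdim K in let k := tdim K' in
    proves V (Imp (tdom K) (exs k (at2 m k 0 F)));
  (* y at 0, the quantifiers moving it to m *)
  iiso_onto : let m := tdim K in
    proves V (Imp (tdom K') (exs m F));
  (* x at 0, y at m, y' at m + k *)
  iiso_fun : let m := tdim K in let k := tdim K' in
    proves V (Imp (And (at2 m 0 m F) (at2 m 0 (m + k) F))
             (at2 k m (m + k) (teq K')));
  (* x at 0, x' at m, y at 2 m *)
  iiso_inj : let m := tdim K in
    proves V (Imp (And (at2 m 0 (2 * m) F) (at2 m m (2 * m) F))
             (at2 m 0 m (teq K)));
  (* x_i at i m, y_i at n m + i k *)
  iiso_rel : forall P : S, let m := tdim K in let k := tdim K' in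
    let n := arity P in
    proves V (Imp (conjs n (fun i => at2 m (i * m) (n * m + i * k) F))
             (Iff (trel K P) (at1 (n * m) (trel K' P)))) }.

Definition iisomorphic (S S' : signature) (V : theory S')
    (K K' : translation S S') : Prop := exists F : form S', is_iiso V K K' F.

(* Equality of K and K' as arrows of INT_0 with target V. *)
Record int0_eq (S S' : signature) (V : theory S') (K K' : translation S S') :
    Prop := Int0Eq {
  int0_dim : tdim K = tdim K';
  int0_dom : proves V (Iff (tdom K) (tdom K'));
  int0_eqt :
    proves V (Imp (conjs 2 (fun i => at1 (i * tdim K) (tdom K)))
                  (Iff (teq K) (teq K')));
  int0_rel : forall P : S,
    proves V (Imp (conjs (arity P) (fun i => at1 (i * tdim K) (tdom K)))
                  (Iff (trel K P) (trel K' P))) }.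

Definition synonymous (S S' : signature) (U : theory S) (V : theory S') : Prop :=
  exists (K : translation S S') (M : translation S' S),
    [/\ interpretation U V K, interpretation V U M,
        int0_eq U (tcomp M K) (tid S) & int0_eq V (tcomp K M) (tid S')].

(* Main.v *)
From mathcomp Require Import all_boot zify.
From mathcomp Require Import boolp classical_sets.
Require Import Defs.

(* The isomorphism F carries the domain of K, modulo its equality, onto the
   whole universe of V, so K can be transported along F to a direct
   interpretation K' : U -> V, and K' o M = id_V holds in V since K o M is
   carried to id_V.  As K' is isomorphic to K, hretract3 gives
   U |- A^(M o K') <-> A for sentences A.  Apply this to the sentence A saying
   that M o K' and id_U agree on a predicate: A^(M o K') says that
   M o K' o M o K' = M o K' agrees with M o K' on it, which is provable, hence
   so is A.
   Provability is replaced by truth in all models; the Henkin completeness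
   theorem is proved for arbitrary signatures, with equality interpreted by a
   congruence so that no quotients are needed. *)

Set Implicit Arguments.
Unset Strict Implicit.
Unset Printing Implicit Defensive.

(** * Extending and concatenating assignments *)

Definition scons (T : Type) (d : T) (e : nat -> T) (i : nat) : T :=
  if i is j.+1 then e j else d.

Definition vcat (T : Type) (q : nat) (w e : nat -> T) (l : nat) : T :=
  if l < q then w l else e (l - q).

Lemma vcat_lt (X : Type) q (w e : nat -> X) l : l < q -> vcat q w e l = w l.
Proof. by rewrite /vcat => ->. Qed.

Lemma vcat_add (X : Type) q (w e : nat -> X) l : vcat q w e (q + l) = e l.
Proof. by rewrite /vcat ltnNge leq_addr /= addKn. Qed.

Lemma vcat_eq (X : Type) q (w e : nat -> X) : vcat q w e q = e 0.
Proof. by rewrite /vcat ltnn subnn. Qed.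

Lemma vcatS (X : Type) q (w e : nat -> X) : vcat q w (scons (w q) e) =1 vcat q.+1 w e.
Proof.
move=> l; rewrite /vcat; case: (ltngtP l q) => h.
- by rewrite ltnS ltnW.
- rewrite ltnS leqNgt h /=.
  by have -> : l - q = (l - q.+1).+1 by lia.
- by rewrite h ltnSn subnn.
Qed.

(** [vcat q w (fun=> d)] is [w] with [d] at index [q]; its later entries are cut off by the outer
    [vcat]. *)
Lemma vcatS_scons (X : Type) q (w : nat -> X) d e :
  vcat q w (scons d e) =1 vcat q.+1 (vcat q w (fun=> d)) e.
Proof.
move=> l; rewrite -vcatS /vcat ltnn.
by case: ifP.
Qed.

(** * Renaming of variables *)

Section Renaming.
Variable S : signature.
Implicit Types A B : form S.

Lemma bounded_some A : exists n, bounded n A.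
Proof.
elim: A => [|i j|P v|A [n hA] B [k hB]|A [n hA]].
- by exists 0.
- by exists (maxn i j).+1; rewrite /= !ltnS leq_maxl leq_maxr.
- exists (\max_(i <- v) i).+1; apply/allP => i iv.
  by rewrite ltnS; apply: leq_bigmax_seq.
- exists (maxn n k); rewrite /= (bounded_le (leq_maxl _ _) hA).
  by rewrite (bounded_le (leq_maxr _ _) hB).
- by exists n; apply: bounded_le hA.
Qed.

Lemma ren_eq_bounded n s t A : bounded n A ->
  (forall i, i < n -> s i = t i) -> ren s A = ren t A.
Proof.
elim: A n s t => //= [i j|P v|A IHA B IHB|A IHA] n s t.
- by case/andP=> hi hj st; rewrite !st.
- move=> hv st; congr Rel; apply: val_inj => /=.
  by apply/eq_in_map => i /(allP hv) /st.
- by case/andP=> hA hB st; rewrite (IHA _ _ _ hA st) (IHB _ _ _ hB st).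
- by move=> hA st; congr All; apply: IHA hA _ => -[|i] //= /st ->.
Qed.

Lemma ren_ext s t A : s =1 t -> ren s A = ren t A.
Proof. by move=> st; have [n hA] := bounded_some A; apply: ren_eq_bounded hA _. Qed.

Lemma ren_id A : ren id A = A.
Proof.
elim: A => //= [P v|A -> B ->|A IHA] //.
- by congr Rel; apply: val_inj; rewrite /= map_id.
- by congr All; rewrite -[RHS]IHA; apply: ren_ext => -[].
Qed.

Lemma ren_comp s t A : ren s (ren t A) = ren (s \o t) A.
Proof.
elim: A s t => //= [P v|A IHA B IHB|A IHA] s t.
- by congr Rel; apply: val_inj; rewrite /= -map_comp.
- by rewrite IHA IHB.
- by rewrite IHA; congr All; apply: ren_ext => -[].
Qed.

Lemma ren_sentence s A : sentence A -> ren s A = A.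
Proof. by move=> hA; rewrite -[RHS]ren_id; apply: ren_eq_bounded hA _. Qed.

Lemma bounded_exs m n A : bounded (m + n) A -> bounded n (exs m A).
Proof. by elim: m n => //= m IHm n hA; rewrite /= !andbT; apply: IHm; rewrite addnS. Qed.

End Renaming.

(** * Structural rules for derivations *)

Section Derivations.
Variables (S : signature) (T : theory S).
Implicit Types (A B : form S) (G : seq (form S)).

Lemma prv_weaken G G' A : List.incl G G' -> prv T G A -> prv T G' A.
Proof.
move=> sub h; elim: h G' sub => {G A}.
- by move=> G A hA G' _; apply: prv_ax.
- by move=> G A hA G' sub; apply/prv_hyp/sub.
- move=> G A B _ IH G' sub; apply/prv_impI/IH.
  by apply: List.incl_cons; [left | apply: List.incl_tl].
- by move=> G A B _ IH1 _ IH2 G' sub; apply: prv_impE (IH1 _ sub) (IH2 _ sub).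
- move=> G A _ IH G' sub; apply/prv_raa/IH.
  by apply: List.incl_cons; [left | apply: List.incl_tl].
- by move=> G A _ IH G' sub; apply/prv_allI/IH/List.incl_map.
- by move=> G A i _ IH G' sub; apply/prv_allE/IH.
- by move=> G i G' _; apply: prv_eqI.
- by move=> G A i j _ IH1 _ IH2 G' sub; apply: prv_eqE (IH1 _ sub) (IH2 _ sub).
Qed.

Lemma prv_ren s G A : prv T G A -> prv T (map (ren s) G) (ren s A).
Proof.
(* Renaming commutes with instantiation; the rules for [All] elimination and for replacing equals
   both need this. *)
have reninst t i B : ren t (ren (inst i) B) = ren (inst (t i)) (ren (up t) B).
  by rewrite !ren_comp; apply: ren_ext => -[].
move=> h; elim: h s => {G A}.
- by move=> G A hA s; rewrite ren_sentence ?(axiom_sentence hA) //; apply: prv_ax.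
- by move=> G A hA s; apply: prv_hyp; apply: List.in_map.
- by move=> G A B _ IH s; apply/prv_impI/(IH s).
- by move=> G A B _ IH1 _ IH2 s; apply: prv_impE (IH1 s) (IH2 s).
- by move=> G A _ IH s; apply/prv_raa/(IH s).
- move=> G A _ IH s; apply: prv_allI; have := IH (up s); rewrite -!map_comp.
  by congr prv; apply: eq_map => B /=; rewrite !ren_comp; apply: ren_ext.
- by move=> G A i _ IH s; rewrite reninst; apply/prv_allE/(IH s).
- by move=> G i s; apply: prv_eqI.
- move=> G A i j _ IH1 _ IH2 s; rewrite reninst; apply: prv_eqE (IH1 s) _.
  by rewrite -reninst; apply: IH2.
Qed.

Lemma prv_cut G A B : prv T G A -> prv T (A :: G) B -> prv T G B.
Proof. by move=> hA /prv_impI hB; apply: prv_impE hB hA. Qed.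

Lemma prv_hyp0 G A : prv T (A :: G) A.
Proof. by apply: prv_hyp; left. Qed.

Lemma prv_weaken1 G A B : prv T G A -> prv T (B :: G) A.
Proof. by apply/prv_weaken/List.incl_tl/List.incl_refl. Qed.

Lemma prv_botE G A : prv T G Bot -> prv T G A.
Proof. by move=> h; apply/prv_raa/prv_weaken1. Qed.

End Derivations.

(** * Models, satisfaction and soundness *)

Record model (S : signature) := Model {
  carrier :> Type;
  point : carrier;
  meq : carrier -> carrier -> Prop;
  mrel : forall P : S, (arity P).-tuple carrier -> Prop;
  meq_refl : forall x, meq x x;
  meq_sym : forall x y, meq x y -> meq y x;
  meq_trans : forall y x z, meq x y -> meq y z -> meq x z;
  mrel_congr : forall P (t t' : (arity P).-tuple carrier),
    (forall i, meq (tnth t i) (tnth t' i)) -> mrel t -> mrel t' }.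
Arguments mrel {S} m P t.

Section Satisfaction.
Variable S : signature.
Implicit Types (N : model S) (A B : form S).

Fixpoint sat N (e : nat -> N) A : Prop :=
  match A with
  | Bot => False
  | Eq i j => meq (e i) (e j)
  | Rel P v => mrel N P (map_tuple e v)
  | Imp A B => sat e A -> sat e B
  | All A => forall d, sat (scons d e) A
  end.

Variable N : model S.
Implicit Types e w : nat -> N.

Lemma sat_congr n A e e' : bounded n A ->
  (forall i, i < n -> meq (e i) (e' i)) -> sat e A <-> sat e' A.
Proof.
elim: A n e e' => //= [i j|P v|A IHA B IHB|A IHA] n e e'.
- case/andP=> hi hj he; split=> h.
    by apply: meq_trans (meq_trans (meq_sym (he _ hi)) h) (he _ hj).
  by apply: meq_trans (meq_trans (he _ hi) h) (meq_sym (he _ hj)).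
- move=> /all_tnthP hv he; split; apply: mrel_congr => i; rewrite !tnth_map;
    first exact/he/hv.
  by apply/meq_sym/he/hv.
- by case/andP=> hA hB he; rewrite (IHA _ _ _ hA he) (IHB _ _ _ hB he).
- move=> hA he; have hs d : sat (scons d e) A <-> sat (scons d e') A.
    by apply: IHA hA _ => -[_|i]; [exact: meq_refl | exact: he].
  by split=> h d; apply/hs.
Qed.

Lemma sat_eq_bounded n A e e' : bounded n A ->
  (forall i, i < n -> e i = e' i) -> sat e A <-> sat e' A.
Proof. by move=> hA he; apply: sat_congr hA _ => i /he ->; apply: meq_refl. Qed.

Lemma sat_ext A e e' : e =1 e' -> sat e A <-> sat e' A.
Proof. by move=> /funext ->. Qed.

Lemma sat_ren s A e : sat e (ren s A) <-> sat (e \o s) A.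
Proof.
elim: A s e => //= [P v|A IHA B IHB|A IHA] s e.
- suff -> : map_tuple e (map_tuple s v) = map_tuple (e \o s) v by [].
  by apply: val_inj; rewrite /= -map_comp.
- by rewrite IHA IHB.
- have hs d : sat (scons d e) (ren (up s) A) <-> sat (scons d (e \o s)) A.
    by rewrite IHA; apply: sat_ext => -[].
  by split=> h d; apply/hs.
Qed.

Lemma sat_imp A B e : sat e (Imp A B) <-> (sat e A -> sat e B).
Proof. by []. Qed.

(** [And] and [Ex] are coded by [Imp], [All] and [Bot], so reading them off takes classical
    logic. *)
Lemma sat_and A B e : sat e (And A B) <-> sat e A /\ sat e B.
Proof.
split=> /= [h|[hA hB] h]; last exact: h.
by apply: contrapT => nh; apply: h => hA hB; apply: nh.
Qed.

Lemma sat_iff A B e : sat e (Iff A B) <-> (sat e A <-> sat e B).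
Proof. by rewrite sat_and. Qed.

Lemma sat_ex A e : sat e (Ex A) <-> exists d, sat (scons d e) A.
Proof.
split=> /= [h|[d hd] h]; last exact: (h d).
by apply: contrapT => nh; apply: h => d hd; apply: nh; exists d.
Qed.

Lemma sat_conjs n f e :
  sat e (conjs n f) <-> forall i, i < n -> sat e (f i).
Proof.
suff h s : sat e (foldr (@And S) Top [seq f i | i <- s]) <->
    (forall i, i \in s -> sat e (f i)).
  by rewrite h; split=> H i hi; apply: H; move: hi; rewrite mem_iota.
elim: s => [|i s IHs]; first by split=> [_ i|_ []].
rewrite [foldr _ _ _]/= sat_and IHs; split=> [[h1 h2] j|h].
  by rewrite inE => /orP[/eqP ->|/h2].
by split=> [|j js]; apply: h; rewrite inE ?eqxx ?js ?orbT.
Qed.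

Lemma sat_alls q A e : sat e (alls q A) <-> forall w, sat (vcat q w e) A.
Proof.
elim: q e => [|q IHq] e /=.
  have h w : sat (vcat 0 w e) A <-> sat e A.
    by apply: sat_ext => l; rewrite /vcat subn0.
  by split=> [hA w|hA]; [apply/h | apply/(h e)].
split=> [h w|h d].
  by apply/(sat_ext _ (vcatS q w e)); move/IHq: (h (w q)); apply.
by apply/IHq => w; apply/(sat_ext _ (vcatS_scons q w d e)).
Qed.

Lemma sat_exs q A e : sat e (exs q A) <-> exists w, sat (vcat q w e) A.
Proof.
elim: q e => [|q IHq] e.
  have h w : sat (vcat 0 w e) A <-> sat e A.
    by apply: sat_ext => l; rewrite /vcat subn0.
  by split=> [hA|[w]]; [exists e|]; rewrite h.
rewrite sat_ex; split=> [[d /IHq[w h]]|[w h]].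
  by exists (vcat q w (fun=> d)); apply/(sat_ext _ (vcatS_scons q w d e)).
by exists (w q); apply/IHq; exists w; apply/(sat_ext _ (vcatS q w e)).
Qed.

Lemma sat_sentence A e e' : sentence A -> sat e A <-> sat e' A.
Proof. by move=> hA; apply: sat_eq_bounded hA _. Qed.

End Satisfaction.

Definition models (S : signature) (N : model S) (T : theory S) : Prop :=
  forall A, axiom T A -> forall e : nat -> N, sat e A.

Lemma soundness (S : signature) (T : theory S) (N : model S) G A :
  models N T -> prv T G A ->
  forall e : nat -> N, (forall B, List.In B G -> sat e B) -> sat e A.
Proof.
move=> hN h; elim: h => {G A}.
- by move=> G A hA e _; apply: hN.
- by move=> G A hA e; apply.
- by move=> G A B _ IH e hG hA; apply: IH => C [<-|/hG].
- by move=> G A B _ IH1 _ IH2 e hG; apply: (IH1 e hG); apply: IH2.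
- move=> G A _ IH e hG; apply: contrapT => nA.
  by apply: (IH e) => C [<-|/hG].
- move=> G A _ IH e hG d; apply: IH => B /List.in_map_iff[C [<- /hG hC]].
  exact/sat_ren.
- move=> G A i _ IH e hG; apply/sat_ren.
  by apply/(sat_ext A (e' := scons (e i) e)); [case | exact: IH].
- by move=> G i e _; apply: meq_refl.
- move=> G A i j _ IH1 _ IH2 e hG; apply/sat_ren.
  (* The two instances differ only in the value of variable 0, and these values are related by
     [meq], not identical. *)
  have /sat_ren := IH2 e hG; have [n hA] := bounded_some A.
  apply: (iffLR (sat_congr hA _)) => -[_|k _]; first exact: (IH1 e hG).
  exact: meq_refl.
Qed.

Lemma proves_sat (S : signature) (T : theory S) (N : model S) A :
  models N T -> proves T A -> forall e : nat -> N, sat e A.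
Proof. by move=> hN hA e; apply: (soundness hN hA). Qed.

Lemma proves_imp_sat (S : signature) (T : theory S) (N : model S) A B :
  models N T -> proves T (Imp A B) -> forall e : nat -> N, sat e A -> sat e B.
Proof. by move=> hN hAB e; apply: (proves_sat hN hAB). Qed.

(** * Henkin completeness *)

Section Completeness.
Local Open Scope classical_set_scope.
Local Open Scope nat_scope.
Variables (S : signature) (T : theory S).
Implicit Types A B : form S.

(* [wit n A e] is a Henkin constant for [All A] under the assignment e.  The
   level n is to exceed the levels of all e i, so that it bounds the nesting of
   Henkin constants. *)
Inductive witness := wvar of nat | wit of nat & form S & (nat -> witness).

Definition level (c : witness) : nat := if c is wit n _ _ then n else 0.

(** A sentence of the language with Henkin constants: the constants sit in the assignment, so the
    syntax of formulas stays as it is. *)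
Definition pform := (form S * (nat -> witness))%type.

(* Provability with constants: as terms are variables, it suffices to read the
   constants as variables in every possible way, injective or not. *)
Definition named (s : witness -> nat) (p : pform) : form S := ren (s \o p.2) p.1.
Definition entails (L : seq pform) (p : pform) : Prop :=
  forall s, prv T (map (named s) L) (named s p).
Definition pbot : pform := (Bot, wvar).
Definition pneg (p : pform) : pform := (Neg p.1, p.2).
Definition consistent (X : set pform) : Prop :=
  forall L, (forall p, List.In p L -> X p) -> ~ entails L pbot.

(** The Henkin axiom A(c) -> All A. The constant c is the value of variable 0, which [ren succn]
    makes the conclusion skip. *)
Definition henkin (n : nat) A (e : nat -> witness) : pform :=
  (Imp A (ren succn (All A)), scons (wit n A e) e).

Lemma entails_weaken L L' p : List.incl L L' -> entails L p -> entails L' p.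
Proof. by move=> sub h s; apply: prv_weaken (h s); apply: List.incl_map. Qed.

(** A constant that occurs nowhere else can be read as an eigenvariable, and a Henkin axiom with its
    constant generalised is classically harmless. *)
Lemma henkin_elim n A e L :
  (forall i, e i <> wit n A e) ->
  (forall p, List.In p L -> forall i, p.2 i <> wit n A e) ->
  entails (henkin n A e :: L) pbot -> entails L pbot.
Proof.
set w := wit n A e => he hL h s.
(* The reading [s'] sends the fresh constant to variable 0 and shifts every other constant out of
   its way. *)
pose s' c := if pselect (c = w) then 0 else (s c).+1.
have s'w : s' w = 0 by rewrite /s'; case: pselect.
have s'N c : c <> w -> s' c = (s c).+1 by rewrite /s'; case: pselect.
pose B := ren (up (s \o e)) A; set G := map (named s) L.
have {}h : prv T (Imp B (ren succn (All B)) :: map (ren succn) G) Bot.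
  have := h s'; rewrite /= /named /= -map_comp; congr (prv T (Imp _ _ :: _) _).
  - by apply: ren_ext => -[|i] //=; rewrite s'N.
  - rewrite /B !ren_comp; congr All; apply: ren_ext => -[|i] //=.
    by rewrite s'N.
  - apply: List.map_ext_in => p /hL hp /=; rewrite ren_comp.
    by apply: ren_ext => i /=; rewrite s'N.
(* If B failed, the Henkin axiom would hold vacuously, contradicting [h]. So B is derivable, and
   variable 0 does not occur in the shifted context. *)
have hB : prv T G (All B).
  apply/prv_allI/prv_raa; apply: prv_cut (prv_weaken _ h).
    apply/prv_impI/prv_botE; apply: prv_impE (prv_hyp0 _ _ _).
    exact/prv_weaken1/prv_hyp0.
  by apply: List.incl_cons; [left | right; right].
have {}h : prv T (map (ren succn) G) Bot.
  apply: prv_cut h; apply/prv_impI/prv_weaken1.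
  exact: (prv_ren succn hB).
(* Generalising over variable 0 and instantiating again undoes the shift of the context. *)
exact: (prv_allE 0 (prv_allI h)).
Qed.

Lemma split_max (X : Type) (f : X -> nat) (s : seq X) : s <> [::] ->
  exists s1 x s2, s = s1 ++ x :: s2 /\ forall y, List.In y s -> f y <= f x.
Proof.
elim: s => // x s IHs _; have [->|/IHs[s1 [z [s2 [-> hz]]]]] := pselect (s = [::]).
  by exists [::], x, [::]; split=> // y [->|].
have [le_xz|lt_zx] := leqP (f x) (f z).
  by exists (x :: s1), z, s2; split=> // y [<-|/hz].
exists [::], x, (s1 ++ z :: s2); split=> // y [->|/hz h] //.
exact: leq_trans h (ltnW lt_zx).
Qed.

(** Henkin axioms are removed one at a time, always one of maximal level: its constant cannot occur
    in the assignments of the remaining ones, whose levels are smaller. *)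
Lemma henkin_conservative (p0 : pform) (H : seq (nat * form S * (nat -> witness))) :
  (forall i, exists k, p0.2 i = wvar k) ->
  (forall h, List.In h H -> forall i, level (h.2 i) < h.1.1) ->
  entails (p0 :: [seq henkin h.1.1 h.1.2 h.2 | h <- H]) pbot ->
  entails [:: p0] pbot.
Proof.
move=> hp0; have [k] := ubnP (size H); elim: k H => // k IHk H leHk hH hent.
have [H0|/(split_max (fun h => h.1.1))] := pselect (H = [::]).
  by move: hent; rewrite H0.
case=> H1 [h [H2 [defH hmax]]].
have inH g : List.In g (H1 ++ H2) -> List.In g H.
  by rewrite defH !List.in_app_iff /=; tauto.
apply: (IHk (H1 ++ H2)).
- by move: leHk; rewrite defH !size_cat /= addnS.
- by move=> g /inH /hH.
have sub : List.incl H (h :: H1 ++ H2).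
  by move=> g; rewrite defH /= !List.in_app_iff /=; tauto.
have hh : List.In h H by rewrite defH List.in_app_iff /=; tauto.
(* If the chosen axiom is listed twice, one copy is simply dropped. *)
have [hin|hnin] := pselect (List.In h (H1 ++ H2)).
  apply: entails_weaken hent; apply: List.incl_cons; first by left.
  apply: List.incl_tl; apply: List.incl_map => g /sub[<-|] //.
apply: (@henkin_elim h.1.1 h.1.2 h.2).
- by move=> i E; have := hH _ hh i; rewrite E /= ltnn.
- move=> p [<- i|/List.in_map_iff[g [<- hg]] [|i]] /=.
  + by have [j ->] := hp0 i.
  (* Henkin constants record their axiom, so equal constants would make [g] and [h] equal. *)
  + case: g h hg hnin {hent hmax sub hh defH} => [[? ?] ?] [[? ?] ?] /=.
    by move=> hg hnin [] E1 E2 E3; subst.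
  + move=> E; have := hH _ (inH _ hg) i; rewrite E /= ltnNge.
    by rewrite (hmax _ (inH _ hg)).
- apply: entails_weaken hent; apply: List.incl_cons; first by right; left.
  move=> p /List.in_map_iff[g [<- /sub[<-|hg]]]; first by left.
  by right; right; apply/List.in_map_iff; exists g.
Qed.

Definition henkin_set : set pform :=
  [set p | exists n A e, p = henkin n A e /\ forall i, level (e i) < n].

Lemma consistent_henkin A : ~ proves T A ->
  consistent (henkin_set `|` [set (Neg A, wvar)]).
Proof.
move=> nA L hL hent; apply: nA.
have [H [hH sub]] : exists H : seq (nat * form S * (nat -> witness)),
    (forall h, List.In h H -> forall i, level (h.2 i) < h.1.1) /\
    List.incl L ((Neg A, wvar) :: [seq henkin h.1.1 h.1.2 h.2 | h <- H]).
  elim: L hL {hent} => [|p L IHL] hL; first by exists [::]; split=> // p.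
  have [|H [hH sub]] := IHL; first by move=> q hq; apply: hL; right.
  have [|[n [B [e [-> he]]]]|/= ->] := hL p; first by left.
    exists ((n, B, e) :: H); split=> [h [<-|/hH] //|q [<-|/sub[]]].
    - by right; left.
    - by left.
    - by right; right.
  by exists H; split=> //; apply: List.incl_cons; first by left.
have {}hent : entails [:: (Neg A, wvar)] pbot.
  by apply: henkin_conservative hH (entails_weaken sub hent) => i; exists i.
(* This reading turns [Neg A] back into itself; its value on Henkin constants is immaterial. *)
pose s c := if c is wvar k then k else 0.
apply: prv_raa; have := hent s; rewrite /= /named /=.
by rewrite (@ren_ext _ (s \o wvar) id) // ren_id.
Qed.

(** Zorn's lemma runs over the sets whose union with X is consistent, instead of the consistent
    supersets of X, so that the empty chain needs no separate treatment. *)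
Lemma lindenbaum (X : set pform) : consistent X ->
  exists Y : set pform, [/\ X `<=` Y, ~ Y pbot,
  forall L p, (forall q, List.In q L -> Y q) -> entails L p -> Y p &
  forall p, Y p \/ Y (pneg p)].
Proof.
move=> consX.
have [F hF totF|Y [consY maxY]] := @Zorn_bigcup _ (fun Y => consistent (X `|` Y)).
  (* A finite list from X and the union of a chain lies already in X and a single member of the
     chain. *)
  move=> L hL; suff [h|[Z FZ h]] : (forall p, List.In p L -> X p) \/
      exists2 Z, F Z & forall p, List.In p L -> (X `|` Z) p.
    - exact: consX h.
    - exact: hF FZ _ h.
  elim: L hL => [|p L IHL] hL; first by left.
  have {}IHL := IHL (fun q hq => hL q (or_intror hq)).
  have [Xp|[Z FZ Zp]] := hL p (or_introl erefl).
    case: IHL => [h|[Z FZ h]]; [left | right; exists Z => //] => q [<-|/h] //.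
    by left.
  right; case: IHL => [h|[Z' FZ' h]].
    by exists Z => // q [<-|/h]; [right | left].
  have [sub|sub] := totF _ _ FZ FZ'.
    by exists Z' => // q [<-|/h] //; right; apply: sub.
  by exists Z => // q [<-|/h[]]; [right | left | move/sub; right].
pose Z := X `|` Y.
(* By maximality, whatever lies outside Z is refuted by finitely many elements of Z. *)
have refute p : ~ Z p -> exists L, (forall q, List.In q L -> Z q) /\
    entails (p :: L) pbot.
  move=> nZp; have : ~ consistent (X `|` (Y `|` [set p])).
    apply: maxY; split; first by move=> q Yq; left.
    by move=> /(_ p (or_intror erefl)) Yp; apply: nZp; right.
  move=> /existsNP[L /not_implyP[hL /contrapT hent]].
  have [L' [hL' sub]] : exists L', (forall q, List.In q L' -> Z q) /\
      List.incl L (p :: L').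
    elim: L hL {hent} => [|q L IHL] hL; first by exists [::]; split=> // q.
    have [|L' [hL' sub]] := IHL; first by move=> r hr; apply: hL; right.
    have [Zq|nZq] := pselect (Z q).
      exists (q :: L'); split=> [r [<-|/hL']//|r [<-|/sub[]]].
      - by right; left.
      - by left.
      - by right; right.
    exists L'; split=> //; apply: List.incl_cons => //; left.
    have [Xq|[Yq|->]] := hL q (or_introl erefl) => //.
      by case: nZq; left.
    by case: nZq; right.
  by exists L'; split=> //; apply: entails_weaken hent.
have closed L p : (forall q, List.In q L -> Z q) -> entails L p -> Z p.
  move=> hL hp; apply: contrapT => /refute[L' [hL' hent]].
  apply: (consY (L ++ L')).
    by move=> q /List.in_app_iff[/hL|/hL'].
  move=> s; rewrite map_cat; apply: (prv_cut (A := named s p)).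
    by apply: prv_weaken (hp s); apply/List.incl_appl/List.incl_refl.
  apply: prv_weaken (hent s); apply: List.incl_cons; first by left.
  exact/List.incl_tl/List.incl_appr/List.incl_refl.
exists Z; split=> //.
- by move=> p Xp; left.
- move=> Zb; apply: (consY [:: pbot]); first by move=> p [<-|].
  by move=> s; apply: prv_hyp0.
- move=> p; have [Zp|/refute[L [hL hent]]] := pselect (Z p); first by left.
  by right; apply: closed hL _ => s; apply/prv_impI/(hent s).
Qed.

Section HenkinModel.
Variable Y : set pform.
Hypothesis Y_henkin : henkin_set `<=` Y.
Hypothesis Y_bot : ~ Y pbot.
Hypothesis Y_closed :
  forall L p, (forall q, List.In q L -> Y q) -> entails L p -> Y p.
Hypothesis Y_complete : forall p, Y p \/ Y (pneg p).

(** Only the readings of a formula matter, so a formula with its assignment can be traded for a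
    renamed formula with the matching assignment. *)
Lemma Y_eq p q : (forall s, named s p = named s q) -> Y p <-> Y q.
Proof.
move=> E; split=> h.
  by apply: (Y_closed (L := [:: p])) => [r [<-|]|s] //; rewrite -E; apply: prv_hyp0.
by apply: (Y_closed (L := [:: q])) => [r [<-|]|s] //; rewrite E; apply: prv_hyp0.
Qed.

Lemma Y_mp A B e : Y (Imp A B, e) -> Y (A, e) -> Y (B, e).
Proof.
move=> hAB hA; apply: (Y_closed (L := [:: (Imp A B, e); (A, e)])).
  by move=> r [<-|[<-|]].
move=> s; apply: prv_impE (prv_hyp0 _ _ _) _.
exact/prv_weaken1/prv_hyp0.
Qed.

Lemma Y_imp A B e : Y (Imp A B, e) <-> (Y (A, e) -> Y (B, e)).
Proof.
split=> [|h]; first exact: Y_mp.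
have [/h hB|hA] := Y_complete (A, e).
  apply: (Y_closed (L := [:: (B, e)])) => [r [<-|]|s] //.
  exact/prv_impI/prv_weaken1/prv_hyp0.
apply: (Y_closed (L := [:: pneg (A, e)])) => [r [<-|]|s] //.
apply/prv_impI/prv_botE; apply: prv_impE (prv_hyp0 _ _ _).
exact/prv_weaken1/prv_hyp0.
Qed.

Lemma Y_allE A e c : Y (All A, e) -> Y (A, scons c e).
Proof.
move=> h; apply: (Y_closed (L := [:: (All A, e)])) => [r [<-|]|s] //.
have := prv_allE (s c) (prv_hyp0 T [::] (named s (All A, e))); congr prv.
by rewrite ren_comp; apply: ren_ext => -[].
Qed.

Lemma Y_all n A e : (forall i, level (e i) < n) ->
  Y (All A, e) <-> forall c, Y (A, scons c e).
Proof.
move=> he; split=> [h c|h]; first exact: Y_allE.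
(* The level bound on [e] is what places this Henkin axiom in [henkin_set]. *)
have hh : Y (henkin n A e) by apply: Y_henkin; exists n, A, e.
have := Y_mp hh (h _); apply: (iffLR (Y_eq _)) => s.
by rewrite /named /= !ren_comp; congr All; apply: ren_ext => -[].
Qed.

Definition heq (c d : witness) : Prop := Y (Eq 0 1, scons c (fun=> d)).
Definition hrel (P : S) (t : (arity P).-tuple witness) : Prop :=
  Y (Rel P (iota_tuple (arity P) 0), nth (wvar 0) t).

Lemma Y_Eq i j e : Y (Eq i j, e) <-> heq (e i) (e j).
Proof. exact: Y_eq. Qed.

Lemma Y_Rel P v e : Y (Rel P v, e) <-> hrel (map_tuple e v).
Proof.
apply: Y_eq => s; rewrite /named /=; congr Rel; apply: val_inj => /=.
rewrite map_comp -[in LHS](mkseq_nth 0 v) /mkseq -!map_comp.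
rewrite size_tuple; apply/eq_in_map => i; rewrite mem_iota /= => hi.
by rewrite (nth_map 0) ?size_tuple.
Qed.

Lemma heq_refl c : heq c c.
Proof. by apply: (Y_closed (L := [::])) => // s; apply: prv_eqI. Qed.

Lemma heq_subst c d A e : heq c d -> Y (A, scons c e) -> Y (A, scons d e).
Proof.
move=> hcd hA; apply: (Y_closed (L := [:: (Eq 0 1, scons c (fun=> d)); (A, scons c e)])).
  by move=> r [<-|[<-|]].
have E s x : named s (A, scons x e) = ren (inst (s x)) (ren (up (s \o e)) A).
  by rewrite ren_comp; apply: ren_ext => -[].
move=> s; rewrite E; apply: (prv_eqE (i := s c)); first exact: prv_hyp0.
by rewrite -E; apply/prv_weaken1/prv_hyp0.
Qed.

Lemma heq_sym c d : heq c d -> heq d c.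
Proof.
by move=> h; apply: (heq_subst (A := Eq 0 1) (e := fun=> c) h); apply: heq_refl.
Qed.

Lemma heq_trans d c x : heq c d -> heq d x -> heq c x.
Proof. by move=> /heq_sym h h'; apply: (heq_subst (A := Eq 0 1) (e := fun=> x) h). Qed.

(** The values are replaced one variable at a time; [mix k] has the new ones below k. *)
Lemma Y_congr n A e e' : bounded n A ->
  (forall i, i < n -> heq (e i) (e' i)) -> Y (A, e) -> Y (A, e').
Proof.
move=> hA he hY; pose mix k i := if i < k then e' i else e i.
have hmix k : k <= n -> Y (A, mix k).
  elim: k => [|k IHk] lt_kn; first exact: hY.
  (* Renaming variable k to 0 brings it to the position where [heq_subst] replaces constants. *)
  pose r i := if i == k then 0 else i.+1.
  have hr x : Y (A, fun i => if i == k then x else mix k i) <->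
      Y (ren r A, scons x (mix k)).
    apply: Y_eq => s; rewrite /named /= ren_comp; apply: ren_ext => i /=.
    by rewrite /r; case: eqP.
  have : Y (ren r A, scons (e' k) (mix k)).
    apply: heq_subst (he _ lt_kn) _; apply/hr.
    apply: (iffLR (Y_eq _)) (IHk (ltnW lt_kn)) => s; apply: ren_ext => i /=.
    by rewrite /mix; have [->|_] := eqVneq i k; rewrite ?ltnn.
  move/hr; apply: (iffLR (Y_eq _)) => s; apply: ren_ext => i /=.
  by rewrite /mix ltnS [i <= k]leq_eqVlt; have [->|_] := eqVneq i k.
have := hmix n (leqnn n); apply: (iffLR (Y_eq _)) => s.
by apply: ren_eq_bounded hA _ => i hi; rewrite /= /mix hi.
Qed.

Lemma hrel_congr P (t t' : (arity P).-tuple witness) :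
  (forall i, heq (tnth t i) (tnth t' i)) -> hrel t -> hrel t'.
Proof.
move=> htt'; apply: Y_congr (id_rel_bounded P) _ => i; rewrite muln1 => hi.
by have := htt' (Ordinal hi); rewrite !(tnth_nth (wvar 0)).
Qed.

Definition henkin_model : model S :=
  @Model S witness (wvar 0) heq hrel heq_refl heq_sym heq_trans hrel_congr.

(** Restricted to assignments of bounded level, since the witness for a universal formula needs a
    level above theirs. Under a quantifier the bound grows to cover the new value. *)
Lemma henkin_truth n A (e : nat -> henkin_model) : (forall i, level (e i) < n) ->
  sat e A <-> Y (A, e).
Proof.
elim: A n e => [|i j|P v|A IHA B IHB|A IHA] n e he.
- split=> // h; apply: Y_bot; move: h; apply: (iffLR (Y_eq _)) => s //.
- by rewrite Y_Eq.
- by rewrite Y_Rel.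
- by rewrite Y_imp -(IHA _ _ he) -(IHB _ _ he).
- rewrite (Y_all A he); have h c : sat (scons c e : nat -> henkin_model) A <-> Y (A, scons c e).
    apply: (IHA (maxn n (level c).+1)) => -[|i] /=.
      by rewrite leq_maxr.
    exact: leq_trans (he i) (leq_maxl _ _).
  by split=> H c; apply/h.
Qed.

Lemma henkin_model_models : models henkin_model T.
Proof.
move=> A hA e; have sA := axiom_sentence hA.
(* The levels in [e] may be unbounded. An axiom is a sentence, so [wvar], of level 0 throughout, can
   take its place. *)
apply/(sat_sentence (N := henkin_model) e (wvar : nat -> henkin_model) sA).
apply/(henkin_truth (n := 1)) => //.
apply: (Y_closed (L := [::])) => // s.
by rewrite /named ren_sentence //; apply: prv_ax.
Qed.

End HenkinModel.

(** If A is unprovable, a completion of the Henkin axioms with [Neg A] gives a model of T in which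
    the assignment [wvar] refutes A. *)
Theorem completeness A :
  (forall N : model S, models N T -> forall e : nat -> N, sat e A) -> proves T A.
Proof.
move=> hA; apply: contrapT => /consistent_henkin /lindenbaum.
case=> Y [sub Y_bot Y_closed Y_complete].
have Y_henkin : henkin_set `<=` Y by move=> p hp; apply: sub; left.
have hN := henkin_model_models Y_henkin Y_bot (Y_closed := Y_closed) Y_complete.
have nA : sat (wvar : nat -> henkin_model Y_closed) (Neg A).
  apply: (iffRL (henkin_truth Y_henkin Y_bot Y_complete (n := 1) (Neg A) _)) => //.
  by apply: sub; right.
exact/nA/hA.
Qed.

End Completeness.

(** * Vectors laid out in consecutive blocks, and the semantics of translations *)

Definition flat (X : Type) (m : nat) (x : nat -> nat -> X) (l : nat) : X :=
  x (l %/ m) (l %% m).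

Lemma flat_blk (X : Type) m (x : nat -> nat -> X) f l : 0 < m ->
  flat m x (blk m f l) = flat m (x \o f) l.
Proof.
move=> m_gt0; rewrite /flat /blk divnMDl // modnMDl modn_mod.
by rewrite (divn_small (ltn_pmod l m_gt0)) addn0.
Qed.

Lemma flat_add (X : Type) m (x : nat -> nat -> X) i l : l < m ->
  flat m x (i * m + l) = x i l.
Proof.
move=> lt_lm; have m_gt0 : 0 < m by apply: leq_trans lt_lm.
by rewrite /flat divnMDl // modnMDl divn_small // addn0 modn_small.
Qed.

Lemma vcat_flat (X : Type) m (v : nat -> X) x l : 0 < m ->
  vcat m v (flat m x) l = flat m (scons v x) l.
Proof.
move=> m_gt0; rewrite /vcat /flat; have [lt_lm|le_ml] := ltnP l m.
  by rewrite divn_small // modn_small.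
have E : l = 1 * m + (l - m) by rewrite mul1n subnKC.
by rewrite [in RHS]E divnMDl // modnMDl add1n.
Qed.

Section TranslationSemantics.
Variables (S S' : signature) (K : translation S S') (N : model S').
Local Notation m := (tdim K).

(** In dimension 0 block arithmetic says nothing, but then the bound makes B a sentence; hence the
    assignments are compared only for [0 < m]. *)
Lemma sat_flat n B (e e' : nat -> N) : bounded (n * m) B ->
  (0 < m -> forall l, l < n * m -> e l = e' l) -> sat e B <-> sat e' B.
Proof.
move=> hB he; apply: sat_eq_bounded hB _ => l hl; apply: he => //.
by case: m hl => //; rewrite muln0.
Qed.

Lemma sat_blk n B f (x : nat -> nat -> N) : bounded (n * m) B ->
  sat (flat m x) (ren (blk m f) B) <-> sat (flat m (x \o f)) B.
Proof.
move=> hB; rewrite sat_ren; apply: sat_flat hB _ => m_gt0 l _.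
exact: flat_blk.
Qed.

Lemma sat_tr_eq i j (x : nat -> nat -> N) :
  sat (flat m x) (tr K (Eq i j)) <-> sat (vcat m (x i) (x j)) (teq K).
Proof.
rewrite /= (sat_blk _ _ (eqt_bounded K)); apply: sat_flat (eqt_bounded K) _.
move=> m_gt0 l hl; rewrite /flat /vcat /=; have [lt_lm|le_ml] := ltnP l m.
  by rewrite divn_small // modn_small.
have E : l = 1 * m + (l - m) by rewrite mul1n subnKC.
have lt_m : l - m < m by rewrite ltn_subLR // addnn -mul2n.
by rewrite [in LHS]E divnMDl // modnMDl divn_small // modn_small.
Qed.

Lemma sat_tr_all A (x : nat -> nat -> N) :
  sat (flat m x) (tr K (All A)) <->
  forall v, sat v (tdom K) -> sat (flat m (scons v x)) (tr K A).
Proof.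
have [n hA] := bounded_some A; have hd := dom_bounded K.
have hdom v : sat (vcat m v (flat m x)) (tdom K) <-> sat v (tdom K).
  by apply: sat_eq_bounded hd _ => l; apply: vcat_lt.
have htr v : sat (vcat m v (flat m x)) (tr K A) <->
    sat (flat m (scons v x)) (tr K A).
  by apply: sat_flat (bounded_tr K hA) _ => m_gt0 l _; apply: vcat_flat.
rewrite sat_alls; split=> h v.
  by move=> /hdom hv; apply/htr/h.
by move=> /hdom hv; apply/htr/h.
Qed.

Lemma sat_tr_alls q A (x : nat -> nat -> N) :
  sat (flat m x) (tr K (alls q A)) <->
  forall w, (forall i, i < q -> sat (w i) (tdom K)) ->
    sat (flat m (vcat q w x)) (tr K A).
Proof.
elim: q x => [|q IHq] x.
  have h w : vcat 0 w x = x by apply: funext => l; rewrite /vcat subn0.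
  by split=> [hA w _|/(_ x)]; rewrite h //; apply.
rewrite [alls _ _]/= sat_tr_all; split=> h w.
  move=> hw; rewrite -(funext (vcatS q w x)).
  apply: (iffLR (IHq _)); first by apply: h; apply: hw.
  by move=> i hi; apply: hw; apply: ltnW.
move=> hw; apply/IHq => w' hw'; rewrite (funext (vcatS_scons q w' w x)).
apply: h => i; rewrite ltnS leq_eqVlt => /orP[/eqP->|hi].
  by rewrite vcat_eq.
by rewrite vcat_lt //; apply: hw'.
Qed.

(** The tuple is padded to an assignment by [point N]; the formula sees only its first [arity P * m]
    variables. *)
Definition inner_rel (P : S) (t : (arity P).-tuple N) : Prop :=
  sat (nth (point N) t) (trel K P).

Lemma inner_rel_congr P (t t' : (arity P).-tuple N) :
  (forall i, meq (tnth t i) (tnth t' i)) -> inner_rel t -> inner_rel t'.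
Proof.
move=> htt'; apply: (iffLR (sat_congr (rel_bounded K P) _)) => i _.
have [hi|hi] := ltnP i (arity P).
  by have := htt' (Ordinal hi); rewrite !(tnth_nth (point N)).
by rewrite !nth_default ?size_tuple //; apply: meq_refl.
Qed.

(* Meaningful for direct K only: the domain, equality and dimension of K are
   ignored. *)
Definition inner : model S :=
  @Model S N (point N) (@meq _ N) inner_rel (@meq_refl _ N) (@meq_sym _ N)
    (@meq_trans _ N) inner_rel_congr.

Hypothesis K_direct : direct K.

(** A direct translation leaves equality and quantifiers as they are, and the inner model reads the
    predicates through K. *)
Lemma sat_tr_direct A (e : nat -> inner) : sat (e : nat -> N) (tr K A) <-> sat e A.
Proof.
have [d1 dom1 eq1] := K_direct.
have blk1 f l : blk 1 f l = f l by rewrite /blk divn1 modn1 addn0 muln1.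
elim: A e => //= [i j|P v|A IHA B IHB|A IHA] e.
- by rewrite eq1 d1 /= !blk1.
- rewrite d1 sat_ren; apply: sat_eq_bounded (rel_bounded K P) _ => l.
  rewrite d1 muln1 => hl; rewrite /= blk1.
  by rewrite (nth_map 0) ?size_tuple.
- by rewrite IHA IHB.
- rewrite d1 dom1 /=; split=> h d; first exact/IHA/h/meq_refl.
  by move=> _; apply/IHA/h.
Qed.

End TranslationSemantics.

Lemma inner_models (S S' : signature) (T : theory S) (T' : theory S')
    (J : translation S S') (N : model S') :
  direct J -> interpretation T T' J -> models N T' -> models (inner J N) T.
Proof.
move=> dJ hJ hN A hA e; apply/(sat_tr_direct dJ).
by apply: (proves_sat hN); apply: hJ; [apply: axiom_sentence hA | apply: prv_ax].
Qed.

(** * An i-isomorphism to the identity, seen inside a model *)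

Section IdentityIso.
Variables (S : signature) (V : theory S) (J : translation S S) (F : form S).
Hypothesis hF : is_iiso V J (tid S) F.
Variables (N : model S).
Hypothesis hN : models N V.
Local Notation m := (tdim J).

Definition graph (m : nat) (F : form S) (x : nat -> N) (y : N) : Prop :=
  sat (vcat m x (fun=> y)) F.
Local Notation fr := (graph m F).

(** Links the copies of F placed at various variables, as in the clauses of [is_iiso], to one
    relation between vectors and elements. *)
Lemma graphE (q a b : nat) (e : nat -> N) x y : bounded (q + 1) F ->
  (forall l, l < q -> e (a + l) = x l) -> e b = y ->
  sat e (at2 q a b F) <-> graph q F x y.
Proof.
move=> hFb hx hy; rewrite sat_ren; apply: sat_eq_bounded hFb _ => l /=.
rewrite addn1 ltnS leq_eqVlt => /orP[/eqP ->|lt_lm].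
  by rewrite ltnn subnn addn0 vcat_eq.
by rewrite lt_lm vcat_lt ?hx.
Qed.

Let hFb : bounded (m + 1) F := iiso_bounded hF.

Lemma iso_dom x y : fr x y -> sat x (tdom J).
Proof.
move=> hxy; have := proves_imp_sat hN (iiso_dom hF) hxy => /sat_and[+ _].
by apply: (iffLR (sat_eq_bounded (dom_bounded J) _)) => l; apply: vcat_lt.
Qed.

Lemma iso_total x : sat x (tdom J) -> exists y, fr x y.
Proof.
move=> hx; have := proves_imp_sat hN (iiso_total hF) hx => /sat_exs[w hw].
(* In [iiso_total] the quantifier puts y at variable 0 and shifts x by one. *)
exists (w 0); move: hw; apply: (iffLR (graphE hFb _ _)) => //= l _.
by rewrite vcat_add.
Qed.

Lemma iso_onto y : exists x, fr x y.
Proof.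
have := proves_imp_sat hN (iiso_onto hF) (e := fun=> y) (meq_refl _).
by move=> /sat_exs.
Qed.

Lemma sat_teq_at a b (e x x' : nat -> N) :
  (forall l, l < m -> e (a + l) = x l) -> (forall l, l < m -> e (b + l) = x' l) ->
  sat e (at2 m a b (teq J)) <-> sat (vcat m x x') (teq J).
Proof.
move=> hx hx'; rewrite sat_ren; apply: sat_eq_bounded (eqt_bounded J) _ => l hl /=.
rewrite /vcat; case: ltnP => h; [exact: hx | apply: hx'].
by rewrite ltn_subLR // addnn -mul2n.
Qed.

Lemma iso_resp x x' y y' : fr x y -> sat x' (tdom J) ->
  sat (vcat m x x') (teq J) -> meq y y' -> fr x' y'.
Proof.
move=> hxy hx' hxx' hyy'.
(* The layout x, x', y, y' at 0, m, 2 m and 2 m + 1 that [iiso_resp] prescribes. *)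
pose e := vcat m x (vcat m x' (scons y (fun=> y'))).
have e1 l : l < m -> e (0 + l) = x l by move=> hl; rewrite /e vcat_lt.
have e2 l : l < m -> e (m + l) = x' l by move=> hl; rewrite /e vcat_add vcat_lt.
have e3 l : e (2 * m + l) = scons y (fun=> y') l.
  by rewrite mul2n -addnn -addnA /e !vcat_add.
have e30 : e (2 * m) = y by rewrite -[2 * m]addn0 e3.
have e31 : e (2 * m + 1) = y' by rewrite e3.
apply/(graphE hFb e2 e31).
have hdom : sat e (And (at1 m (tdom J)) (at1 (2 * m + 1) (tdom (tid S)))).
  apply/sat_and; split; last exact: meq_refl.
  apply/sat_ren; move: hx'.
  by apply: (iffLR (sat_eq_bounded (dom_bounded J) _)) => l /e2.
have heq : sat e (And (at2 m 0 m (teq J))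
                      (at2 1 (2 * m) (2 * m + 1) (teq (tid S)))).
  apply/sat_and; split; first exact/(sat_teq_at e1 e2).
  by rewrite /= subnn !addn0 e31 e30.
have hxyF : sat e (at2 m 0 (2 * m) F) by apply/(graphE hFb e1 e30).
exact: (proves_imp_sat hN (iiso_resp hF) hdom heq hxyF).
Qed.

Lemma iso_fun x y y' : fr x y -> fr x y' -> meq y y'.
Proof.
move=> hy hy'; pose e := vcat m x (scons y (fun=> y')).
have e1 l : l < m -> e (0 + l) = x l by move=> hl; rewrite /e vcat_lt.
have e2 : e m = y by rewrite /e vcat_eq.
have e3 : e (m + 1) = y' by rewrite /e vcat_add.
have h : sat e (And (at2 m 0 m F) (at2 m 0 (m + 1) F)).
  by apply/sat_and; split; [apply/(graphE hFb e1 e2) | apply/(graphE hFb e1 e3)].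
have := proves_imp_sat hN (iiso_fun hF) h.
by rewrite /= subnn !addn0 e2 e3.
Qed.

Lemma iso_inj x x' y : fr x y -> fr x' y -> sat (vcat m x x') (teq J).
Proof.
move=> hx hx'; pose e := vcat m x (vcat m x' (fun=> y)).
have e1 l : l < m -> e (0 + l) = x l by move=> hl; rewrite /e vcat_lt.
have e2 l : l < m -> e (m + l) = x' l by move=> hl; rewrite /e vcat_add vcat_lt.
have e3 : e (2 * m) = y by rewrite mul2n -addnn /e vcat_add vcat_eq.
apply/(sat_teq_at e1 e2); apply: (proves_imp_sat hN (iiso_inj hF) (e := e)).
by apply/sat_and; split; [apply/(graphE hFb e1 e3) | apply/(graphE hFb e2 e3)].
Qed.

Lemma iso_eq x x' y y' : fr x y -> fr x' y' ->
  sat (vcat m x x') (teq J) <-> meq y y'.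
Proof.
move=> hxy hx'y'; split=> h.
  exact: iso_fun (iso_resp hxy (iso_dom hx'y') h (meq_refl _)) hx'y'.
(* Reflexivity of the equality of J at x comes from injectivity, applied to x and x itself. *)
have hxy' := iso_resp hxy (iso_dom hxy) (iso_inj hxy hxy) h.
exact: iso_inj hxy' hx'y'.
Qed.

Lemma iso_rel P (x : nat -> nat -> N) (y : nat -> N) :
  (forall i, i < arity P -> fr (x i) (y i)) ->
  sat (flat m x) (trel J P) <-> sat y (id_rel P).
Proof.
move=> hxy; pose e := vcat (arity P * m) (flat m x) y.
have hconj : sat e (conjs (arity P)
    (fun i => at2 m (i * m) (arity P * m + i * 1) F)).
  apply/sat_conjs => i hi.
  apply: (iffRL (graphE hFb _ _)) (hxy i hi) => [l hl|].
    by rewrite /e vcat_lt ?flat_add //; nia.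
  by rewrite /e muln1 vcat_add.
have /sat_iff h := proves_imp_sat hN (iiso_rel hF P) hconj.
have h1 : sat e (trel J P) <-> sat (flat m x) (trel J P).
  by apply: sat_eq_bounded (rel_bounded J P) _ => l; apply: vcat_lt.
rewrite -h1 h sat_ren; apply: sat_ext => l; exact: vcat_add.
Qed.

End IdentityIso.

(** * What an interpretation guarantees in models of its target *)

Lemma tr_conjs (S S' : signature) (K : translation S S') n f :
  tr K (conjs n f) = conjs n (fun i => tr K (f i)).
Proof. by rewrite /conjs; elim: (iota 0 n) => //= i s ->. Qed.

Section InterpretationSemantics.
Variables (S S' : signature) (T : theory S) (T' : theory S').
Variable K : translation S S'.
Hypothesis hK : interpretation T T' K.
Variable N : model S'.
Hypothesis hN : models N T'.
Local Notation m := (tdim K).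

Lemma sat_flat_ext n B (x x' : nat -> nat -> N) : bounded (n * m) B ->
  (forall i, i < n -> x i = x' i) -> sat (flat m x) B <-> sat (flat m x') B.
Proof.
move=> hB hx; apply: sat_flat hB _ => m_gt0 l hl.
by rewrite /flat hx // ltn_divLR.
Qed.

Lemma interp_eq_refl x : sat x (tdom K) -> sat (vcat m x x : nat -> N) (teq K).
Proof.
move=> hx; have hA : proves T (All (Eq 0 0)) by apply/prv_allI/prv_eqI.
have := proves_sat hN (hK (A := All (Eq 0 0)) isT hA) (flat m (fun=> x)).
by move=> /sat_tr_all /(_ x hx) /sat_tr_eq.
Qed.

(** That P respects identity is a theorem of T, so its translation holds in N; the universally
    closed sentence is instantiated with the vectors x followed by x'. *)
Lemma interp_rel_congr P (x x' : nat -> nat -> N) :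
  (forall i, i < arity P -> sat (x i) (tdom K)) ->
  (forall i, i < arity P -> sat (x' i) (tdom K)) ->
  (forall i, i < arity P -> sat (vcat m (x i) (x' i)) (teq K)) ->
  sat (flat m x) (trel K P) -> sat (flat m x') (trel K P).
Proof.
set n := arity P => hx hx' hxx'.
pose A := Imp (conjs n (fun i => Eq i (n + i)))
  (Imp (Rel P (iota_tuple n 0)) (Rel P (iota_tuple n n))).
have hA : sentence (alls (n + n) A).
  apply: bounded_alls; rewrite addn0 /=; apply/and3P; split.
  - by apply: bounded_conjs => i hi /=; rewrite ltn_add2l hi ltn_addr.
  - by apply/allP => i; rewrite mem_iota /= => /ltn_addr ->.
  - by apply/allP => i; rewrite mem_iota => /andP[].
have pA : proves T (alls (n + n) A).
  apply: completeness => N' hN' e; apply/sat_alls => w.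
  move=> /= /sat_conjs h; apply: mrel_congr => i.
  rewrite !tnth_map !(tnth_nth 0) /= !nth_iota //.
  exact: (h i (ltn_ord i)).
have /sat_tr_alls h := proves_sat hN (hK hA pA) (flat m x).
pose w := vcat (n + n) (vcat n x x') x.
have w0 i : i < n -> w i = x i by move=> hi; rewrite /w !vcat_lt // ltn_addr.
have w1 i : i < n -> w (n + i) = x' i.
  by move=> hi; rewrite /w vcat_lt ?ltn_add2l // vcat_add.
have hrel y k : (forall i, i < n -> w (k + i) = y i) ->
    sat (flat m w) (tr K (Rel P (iota_tuple n k))) <-> sat (flat m y) (trel K P).
  move=> hy; rewrite /= (sat_blk _ _ (rel_bounded K P)).
  by apply: sat_flat_ext (rel_bounded K P) _ => i hi /=; rewrite nth_iota ?hy.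
have {}h : sat (flat m w) (tr K A).
  apply: h => i hi; rewrite /vcat; case: ltnP => h; first exact: hx.
  by apply: hx'; rewrite ltn_subLR.
have heq : sat (flat m w) (tr K (conjs n (fun i => Eq i (n + i)))).
  rewrite tr_conjs; apply/sat_conjs => i hi; apply/sat_tr_eq.
  by rewrite w0 // w1 //; apply: hxx'.
by move/(hrel x 0 w0) => hP; apply/(hrel x' n w1)/(h heq hP).
Qed.

End InterpretationSemantics.

(** * Transport of K to a direct translation *)

Section Directification.
Variables (S S' : signature) (K : translation S S') (F : form S').
Local Notation m := (tdim K).
Hypothesis hFb : bounded (m + 1) F.

(** P holds of y when some preimages of the y_i under F satisfy P in the sense of K. The preimages
    occupy the first [arity P * m] variables and the y_i follow. *)
Definition dir_rel (P : S) : form S' :=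
  exs (arity P * m)
    (And (conjs (arity P) (fun i => at2 m (i * m) (arity P * m + i) F)) (trel K P)).

Lemma dir_rel_bounded P : bounded (arity P * 1) (dir_rel P).
Proof.
apply: bounded_exs; rewrite /= !andbT muln1; apply/andP; split; last first.
  exact: bounded_le (leq_addr _ _) (rel_bounded K P).
apply: bounded_conjs => i hi; apply: bounded_ren hFb => l.
by case: ifP; nia.
Qed.

(* The transport of K along the bijection F(x, y). *)
Definition directify : translation S S' :=
  @Translation S S' 1 (Eq 0 0) (Eq 0 1) dir_rel isT isT dir_rel_bounded.

Lemma directify_direct : direct directify.
Proof. by []. Qed.

Variable N : model S'.
Local Notation fr := (@graph S' N m F).

Lemma sat_dir_rel P (y : nat -> N) : sat y (dir_rel P) <->
  exists x, (forall i, i < arity P -> fr (x i) (y i)) /\ sat (flat m x) (trel K P).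
Proof.
have hg x w i : i < arity P ->
    (forall l, l < m -> w (i * m + l) = x i l) ->
    sat (vcat (arity P * m) w y) (at2 m (i * m) (arity P * m + i) F) <->
    fr (x i) (y i).
  move=> hi hw; apply: graphE => // [l hl|]; last by rewrite vcat_add.
  by rewrite vcat_lt ?hw //; nia.
have hP w e : sat (vcat (arity P * m) w e) (trel K P) <-> sat (w : nat -> N) (trel K P).
  by apply: sat_eq_bounded (rel_bounded K P) _ => l; apply: vcat_lt.
rewrite sat_exs; split=> [[w /sat_and[/sat_conjs h1 /hP h2]]|[x [h1 h2]]].
  exists (fun i l => w (i * m + l)); split.
    by move=> i hi; apply/(hg (fun i l => w (i * m + l)) w i hi) => //; apply: h1.
  move: h2; apply: (iffLR (sat_flat (rel_bounded K P) _)) => _ l _.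
  by rewrite /flat -divn_eq.
exists (flat m x); apply/sat_and; split; last exact/hP.
by apply/sat_conjs => i hi; apply/hg; [| move=> l; apply: flat_add | apply: h1].
Qed.

(** The graph of F is a bijection from the domain of K, modulo the equality of K, onto N. This is
    assumed of the graph in N because F will be given as an i-isomorphism for [K o M], not for K. *)
Hypothesis g_dom : forall x y, fr x y -> sat x (tdom K).
Hypothesis g_total : forall x, sat x (tdom K) -> exists y, fr x y.
Hypothesis g_onto : forall y, exists x, fr x y.
Hypothesis g_eq : forall x x' y y', fr x y -> fr x' y' ->
  sat (vcat m x x') (teq K) <-> meq y y'.
Hypothesis g_rel : forall P (x x' : nat -> nat -> N) y,
  (forall i, i < arity P -> fr (x i) (y i)) ->
  (forall i, i < arity P -> fr (x' i) (y i)) ->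
  sat (flat m x) (trel K P) -> sat (flat m x') (trel K P).

(** Isomorphic structures satisfy the same formulas: equality is [g_eq], predicates need the
    independence of preimages [g_rel], and quantifiers use that F is total and onto. *)
Lemma sat_directify A x (y : nat -> inner directify N) :
  (forall i, fr (x i) (y i)) -> sat (flat m x) (tr K A) <-> sat y A.
Proof.
elim: A x y => [|i j|P v|A IHA B IHB|A IHA] x y hxy //.
- by rewrite sat_tr_eq (g_eq (hxy i) (hxy j)).
- rewrite /= (sat_blk _ _ (rel_bounded K P)) /inner_rel sat_dir_rel.
  have hv i : i < arity P -> nth (point N) (map y v) i = y (nth 0 v i).
    by move=> hi; rewrite (nth_map 0) ?size_tuple.
  split=> [h|[x' [h1 h2]]].
    by exists (x \o nth 0 v); split=> // i hi; rewrite /= hv.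
  by apply: g_rel h1 _ h2 => i hi; rewrite /= hv.
- by rewrite /= (IHA _ _ hxy) (IHB _ _ hxy).
- rewrite sat_tr_all; split=> h.
    move=> d; have [v hv] := g_onto d; have := h v (g_dom hv).
    by apply: (iffLR (IHA _ _ _)) => -[].
  move=> v /g_total[d hd]; have := h d.
  by apply: (iffRL (IHA _ _ _)) => -[].
Qed.

End Directification.

(** * Composition with direct translations *)

Section DirectComposition.
Variables (S S' S'' : signature) (M : translation S' S'') (K : translation S S').
Variable N : model S''.
Hypothesis M_direct : direct M.

(** Reading [M o K] in N is reading K in the inner model of M; the conjuncts that the composition
    adds to the domain are instances of [Eq 0 0]. *)
Lemma sat_tcomp_direct A (e : nat -> inner M N) :
  sat (e : nat -> N) (tr (tcomp M K) A) <-> sat e (tr K A).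
Proof.
have [d1 dom1 eq1] := M_direct.
elim: A e => //= [i j|P v|A IHA B IHB|A IHA] e.
- by rewrite d1 muln1 !sat_ren -sat_tr_direct.
- by rewrite d1 muln1 !sat_ren -sat_tr_direct.
- by rewrite IHA IHB.
- rewrite !sat_alls d1 muln1.
  have hdom w : sat (vcat (tdim K) w e : nat -> N) (comp_dom M K) <->
      sat (vcat (tdim K) w e : nat -> inner M N) (tdom K).
    rewrite sat_and sat_tr_direct //; split=> [[]//|h]; split=> //.
    by apply/sat_conjs => j _; rewrite dom1; apply: meq_refl.
  by split=> h w /hdom hw; apply/IHA/h.
Qed.

End DirectComposition.

(** For direct translations dimension, domain and equality match the identity outright, so only
    predicates remain, and by completeness models decide these. *)
Lemma int0_eq_tid (S S' : signature) (T : theory S) (J : translation S S')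
    (J' : translation S' S) : direct J -> direct J' ->
  (forall (N : model S) P (e : nat -> N), models N T ->
    sat e (tr J' (trel J P)) <-> sat e (id_rel P)) ->
  int0_eq T (tcomp J' J) (tid S).
Proof.
move=> [d1 dom1 eq1] dJ' h; have [d1' dom1' eq1'] := dJ'.
split=> [|||P].
- by rewrite /= d1 d1'.
- apply: completeness => N hN e; apply/sat_iff; split=> _; first exact: meq_refl.
  apply/sat_and; split; last by rewrite dom1; apply/sat_tr_direct => //; apply: meq_refl.
  by apply/sat_conjs => j _; rewrite dom1'; apply: meq_refl.
- apply: completeness => N hN e; apply/sat_imp => _; apply/sat_iff.
  by rewrite /= eq1 sat_tr_direct.
- by apply: completeness => N hN e; apply/sat_imp => _; apply/sat_iff/h.
Qed.

(** * The two retractions and the synonymy *)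

Section Retract.
Variables (SU SV : signature) (U : theory SU) (V : theory SV).
Variables (K : translation SU SV) (M : translation SV SU) (F : form SV).
Hypothesis hK : interpretation U V K.
Hypothesis hM : interpretation V U M.
Hypothesis hF : is_iiso V (tcomp K M) (tid SV) F.
Hypothesis M_direct : direct M.
Local Notation m := (tdim K).

Lemma tdim_retract : tdim (tcomp K M) = m.
Proof. by case: M_direct => /= -> _ _; rewrite mul1n. Qed.

Lemma retract_bounded : bounded (m + 1) F.
Proof. by rewrite -tdim_retract; apply: iiso_bounded hF. Qed.

Let K' := directify retract_bounded.

Section InModel.
Variable N : model SV.
Hypothesis hN : models N V.
Local Notation fr := (@graph SV N m F).

(** The second conjunct is the translation by K of the domain [Eq 0 0] of M. *)
Lemma sat_retract_dom (x : nat -> N) : sat x (tdom (tcomp K M)) <->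
  sat x (tdom K) /\ sat (vcat m x x) (teq K).
Proof.
have [d1 dom1 _] := M_direct; rewrite sat_and d1 dom1 sat_conjs.
have h0 : sat x (ren (addn (0 * m)) (tdom K)) <-> sat x (tdom K).
  by rewrite sat_ren; apply: sat_ext.
have -> : sat x (tr K (Eq 0 0)) <-> sat (vcat m x x) (teq K).
  rewrite -(sat_tr_eq K 0 0 (fun=> x)).
  have hb : bounded (1 * m) (tr K (Eq 0 0)) by apply: bounded_tr.
  apply: sat_flat hb _ => _ l; rewrite mul1n => hl.
  by rewrite /flat modn_small.
split=> [[/(_ 0 isT) /h0]//|[h1 h2]]; split=> // -[|//] _.
exact/h0.
Qed.

Lemma sat_retract_eq (x x' : nat -> N) :
  sat (vcat m x x') (teq (tcomp K M)) <-> sat (vcat m x x') (teq K).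
Proof.
have [_ _ eq1] := M_direct; rewrite /= eq1.
rewrite -(sat_tr_eq K 0 1 (scons x (fun=> x'))).
have hb : bounded (2 * m) (tr K (Eq 0 1)) by apply: bounded_tr.
apply: sat_flat hb _ => m_gt0 l hl; rewrite -vcat_flat // /vcat.
case: ltnP => // le_ml; rewrite /flat modn_small //.
by rewrite ltn_subLR // addnn -mul2n.
Qed.

Lemma retract_dom x y : fr x y -> sat x (tdom K).
Proof.
by move=> h; have /sat_retract_dom[] : sat x (tdom (tcomp K M))
  by apply: (iso_dom hF hN (y := y)); rewrite tdim_retract.
Qed.

Lemma retract_total x : sat x (tdom K) -> exists y, fr x y.
Proof.
move=> hx; rewrite -tdim_retract; apply: (iso_total hF hN).
by apply/sat_retract_dom; split=> //; apply: (interp_eq_refl hK hN).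
Qed.

Lemma retract_onto y : exists x, fr x y.
Proof. by rewrite -tdim_retract; apply: (iso_onto hF hN). Qed.

Lemma retract_eq x x' y y' : fr x y -> fr x' y' ->
  sat (vcat m x x') (teq K) <-> meq y y'.
Proof.
rewrite -sat_retract_eq -tdim_retract; exact: (iso_eq hF hN).
Qed.

(** The i-isomorphism F speaks of the predicates of V only. For those of U, two preimages of the
    same point are equal in the sense of K, and K respects its equality because it interprets U. *)
Lemma retract_rel P (x x' : nat -> nat -> N) y :
  (forall i, i < arity P -> fr (x i) (y i)) ->
  (forall i, i < arity P -> fr (x' i) (y i)) ->
  sat (flat m x) (trel K P) -> sat (flat m x') (trel K P).
Proof.
move=> hx hx'; apply: (interp_rel_congr hK hN) => i hi.
- exact: retract_dom (hx i hi).
- exact: retract_dom (hx' i hi).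
- by apply/(retract_eq (hx i hi) (hx' i hi)); apply: meq_refl.
Qed.

Lemma sat_retract A x (y : nat -> inner K' N) :
  (forall i, fr (x i) (y i)) -> sat (flat m x) (tr K A) <-> sat y A.
Proof.
exact: (sat_directify (hFb := retract_bounded) retract_dom retract_total
  retract_onto retract_eq retract_rel).
Qed.

Lemma retract_lift (y : nat -> N) : exists x, forall i, fr (x i) (y i).
Proof. by have [x hx] := choice retract_onto; exists (x \o y) => i; apply: hx. Qed.

(** On preimages of e under F, K' becomes K, and F carries [K o M] to the identity. *)
Lemma sat_retract_rel R (e : nat -> N) :
  sat e (tr K' (trel M R)) <-> sat e (id_rel R).
Proof.
have [x hx] := retract_lift e.
rewrite (sat_tr_direct (directify_direct _)) -(sat_retract (trel M R) hx).
rewrite -[X in flat X]tdim_retract; apply: (iso_rel hF hN) => i _.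
by rewrite tdim_retract.
Qed.

(** The identity [K' o M = id_V] in terms of models: the inner model of K' in N has N itself as its
    inner model of M. *)
Lemma sat_inner_inner B (e : nat -> N) :
  sat (e : nat -> inner M (inner K' N)) B <-> sat e B.
Proof.
elim: B e => //= [R v|A IHA B IHB|A IHA] e.
- rewrite /inner_rel /=.
  rewrite -(sat_tr_direct (K := K') (N := N) (directify_direct _)) sat_retract_rel /=.
  suff -> : map_tuple (nth (point N) (map_tuple e v)) (iota_tuple (arity R) 0) =
    map_tuple e v by [].
  apply: val_inj => /=; rewrite map_nth_iota0 ?size_map ?size_tuple //.
  by rewrite take_oversize // size_map size_tuple.
- by rewrite IHA IHB.
- by split=> h d; apply/IHA.
Qed.

End InModel.

Lemma directify_interpretation : interpretation U V K'.
Proof.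
move=> A sA hA; apply: completeness => N hN e.
have [x hx] := retract_lift hN e.
apply/(sat_tr_direct (directify_direct _))/(sat_retract hN A hx).
exact: (proves_sat hN (hK sA hA)).
Qed.

Hypothesis hretract3 : forall A : form SU, sentence A ->
  proves U (Iff (tr (tcomp M K) A) A).

Lemma sat_corestrict_rel (N : model SU) P (e : nat -> N) : models N U ->
  sat e (tr M (trel K' P)) <-> sat e (id_rel P).
Proof.
move=> hN; have hN1 := inner_models M_direct hM hN.
set N1 := inner M N in hN1; pose N2 := inner K' N1.
(* A is the universal sentence that [M o K'] and the identity agree on P. *)
pose B := Iff (tr M (trel K' P)) (id_rel P); pose A := alls (arity P) B.
have sA : sentence A.
  apply: bounded_alls; rewrite addn0.
  have h1 := bounded_tr M (rel_bounded K' P); have h2 := id_rel_bounded P.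
  have [d1 _ _] := M_direct; rewrite d1 !muln1 in h1 h2.
  by rewrite /= h1 !andbT; apply/andP.
(* In [N2] the translation by M is evaluated in the inner model of M, which is [N1] again, and there
   [trel K' P] defines P of [N2]. *)
have hA2 (y : nat -> N2) : sat y A.
  apply/sat_alls => w; set z := vcat _ _ _; apply/sat_iff.
  rewrite (sat_tr_direct M_direct) (sat_inner_inner hN1) /= /inner_rel.
  apply: sat_eq_bounded (dir_rel_bounded retract_bounded P) _ => i.
  by rewrite muln1 => hi /=; rewrite (nth_map 0) ?size_iota // nth_iota.
(* Along preimages of e, the truth of A in [N2] becomes that of [tr K A] in [N1], then that of the
   translation by [M o K] in N, where [hretract3] gives A itself. *)
have [x hx] := retract_lift hN1 (e : nat -> N1).
have := hA2 e => /(sat_retract hN1 A hx) /(sat_tcomp_direct K M_direct) hA1.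
have /sat_iff[/(_ hA1) /sat_alls /(_ e) /sat_iff h _] :=
  proves_sat hN (hretract3 sA) (flat m x : nat -> N).
(* After instantiation at e the tail [flat m x] is left over; both sides of B see only the first
   [arity P] variables. *)
have ve l : l < arity P * 1 -> vcat (arity P) e (flat m x) l = e l.
  by rewrite muln1; apply: vcat_lt.
rewrite -(sat_eq_bounded (id_rel_bounded P) ve) -h.
have hb := bounded_tr M (rel_bounded K' P); have [d1 _ _] := M_direct.
rewrite d1 muln1 in hb; apply: iff_sym; exact: sat_eq_bounded hb ve.
Qed.

Lemma retract_synonymous : synonymous U V.
Proof.
exists K', M; split=> //; first exact: directify_interpretation.
  by apply: int0_eq_tid => // N P e hN; apply: sat_corestrict_rel.
by apply: int0_eq_tid => // N R e hN; apply: sat_retract_rel.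
Qed.

End Retract.

Theorem theorem5p2 (SU SV : signature) (U : theory SU) (V : theory SV)
    (K : translation SU SV) (M : translation SV SU)
    (hK : interpretation U V K) (hM : interpretation V U M)
    (hretract1 : iisomorphic V (tcomp K M) (tid SV))
    (hretract3 : forall A : form SU, sentence A ->
       proves U (Iff (tr (tcomp M K) A) A))
    (hdirect : direct M) :
  synonymous U V.
Proof.
by have [F hF] := hretract1; apply: (retract_synonymous hK hM hF).
Qed.
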